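(* Fix $\varepsilon>0$ and a dataset $D=\{(x_i,y_i)\}_{i=1}^n$ with $x_i,y_i\in[0,1]$. With the noisy statistics and $\tilde n_x$ defined in the context, define $\hat S_{xy}:=\frac56\tilde S_{xy}+\frac16\bigl[\tilde n_x-(\tilde S_{(1-x)y}+\tilde S_{1-y})\bigr]$. Then $\hat S_{xy}$ is an unbiased estimator of $S_{xy}=\sum_i x_iy_i$ with variance $\mathrm{Var}(\hat S_{xy})=\frac{20}{3\varepsilon^2}$.
   Context: Let $\varepsilon_1=\varepsilon_2=\varepsilon/2$. Define the statistics $S_{x^2}=\sum_i x_i^2$, $S_{x-x^2}=\sum_i (x_i-x_i^2)$, $S_{1-x}=\sum_i(1-x_i)$, $S_{xy}=\sum_i x_iy_i$, $S_{(1-x)y}=\sum_i (1-x_i)y_i$, $S_{1-y}=\sum_i(1-y_i)$. Let $Z_{11},Z_{12},Z_{13}\stackrel{iid}{\sim}\mathrm{Lap}(1/\varepsilon_1)$ and $Z_{21},Z_{22},Z_{23}\stackrel{iid}{\sim}\mathrm{Lap}(1/\varepsilon_2)$, all six mutually independent, where $\mathrm{Lap}(b)$ is the zero-mean Laplace distribution with density $\frac{1}{2b}e^{-|z|/b}$. Set $\tilde S_{x^2}=S_{x^2}+Z_{11}$, $\tilde S_{x-x^2}=S_{x-x^2}+Z_{12}$, $\tilde S_{1-x}=S_{1-x}+Z_{13}$, $\tilde S_{xy}=S_{xy}+Z_{21}$, $\tilde S_{(1-x)y}=S_{(1-x)y}+Z_{22}$, $\tilde S_{1-y}=S_{1-y}+Z_{23}$,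 and $\tilde n_x=\tilde S_{x^2}+\tilde S_{x-x^2}+\tilde S_{1-x}$, $\tilde n_y=\tilde S_{xy}+\tilde S_{(1-x)y}+\tilde S_{1-y}$. The dataset is fixed; expectations and variances are over the noise. *)

(* Defs.v *)
From HB Require Import structures.
From mathcomp Require Import all_boot all_order all_algebra.
From mathcomp Require Import all_classical all_reals all_analysis.
Set Implicit Arguments. Unset Strict Implicit. Unset Printing Implicit Defensive.
Import Order.TTheory GRing.Theory Num.Theory.
Local Open Scope classical_set_scope.
Local Open Scope ring_scope.

Definition laplace_pdf {R : realType} (b : R) (z : R) : R :=
  (2 * b)^-1 * expR (- `|z| / b).

Definition is_laplace {d} {T : measurableType d} {R : realType}
  (P : probability T R) (X : {RV P >-> R}) (b : R) : Prop :=
  forall A : set R, measurable A ->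
    distribution P X A =
      (\int[@lebesgue_measure R]_(z in A) (laplace_pdf b z)%:E)%E.

Definition mutually_independent {d} {T : measurableType d} {R : realType}
  (P : probability T R) (I : finType) (Z : I -> {RV P >-> R}) : Prop :=
  forall (J : {set I}) (A : I -> set R), (forall i, measurable (A i)) ->
    P (\big[setI/setT]_(i in J) (Z i @^-1` A i)) =
      (\prod_(i in J) P (Z i @^-1` A i))%E.
Arguments is_laplace {d T R} P X b.
Arguments mutually_independent {d T R} P {I} Z.

(* Main.v *)
(* The three released statistics in each query add up to [n] before noise, so
   that with [Z] the noise,
   [hS_xy = S_xy + 5/6 Z21 + (Z11 + Z12 + Z13 - Z22 - Z23) / 6].
   A Laplace variable of scale [b] has mean 0 by symmetry of its law, and
   variance [2 b^2]; here [b = 2 / eps].  Independence makes the six noises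
   uncorrelated (Fubini on the product of their laws), so the variance is
   [(25 + 5) / 36 * 8 / eps^2 = 20 / (3 eps^2)]. *)
Require Import Defs.
From HB Require Import structures.
From mathcomp Require Import all_boot all_order all_algebra.
From mathcomp Require Import all_classical all_reals all_analysis.
From mathcomp Require Import measurable_realfun ring lra.
Set Implicit Arguments.
Unset Strict Implicit.
Unset Printing Implicit Defensive.
Import Order.TTheory GRing.Theory Num.Theory.
Import numFieldNormedType.Exports.
Local Open Scope classical_set_scope.
Local Open Scope ring_scope.

(** * Integration against a density, square integrability, and a decay limit *)

Lemma ge0_integral_density d (T : measurableType d) (R : realType)
    (nu : {finite_measure set T -> \bar R})
    (mu : {sigma_finite_measure set T -> \bar R}) (g f : T -> \bar R) :
  measurable_fun [set: T] g -> (forall x, (0 <= g x)%E) ->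
  (forall A, measurable A -> nu A = (\int[mu]_(x in A) g x)%E) ->
  measurable_fun [set: T] f -> (forall x, (0 <= f x)%E) ->
  (\int[nu]_x f x = \int[mu]_x (f x * g x))%E.
Proof.
move=> mg g0 nuE mf f0.
(* Having a density makes [nu] absolutely continuous, so a Radon-Nikodym derivative exists. It
   equals [g] almost everywhere, since both have the same integral over every measurable set. *)
have numu : nu `<< mu.
  apply/null_content_dominatesP => A mA muA0.
  by rewrite nuE// null_set_integral//; exact: measurable_funTS.
have mRN := measurable_int _ (Radon_Nikodym_SigmaFinite.f_integrable numu).
rewrite -(Radon_Nikodym_SigmaFinite.change_of_variables numu)//.
apply: ae_eq_integral => //.
- exact: emeasurable_funM.
- exact: emeasurable_funM.
- apply: ae_eqe_mul2l; apply: integral_ae_eq => //.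
    exact: Radon_Nikodym_SigmaFinite.f_integrable.
  move=> E _ mE.
  by rewrite -nuE// -Radon_Nikodym_SigmaFinite.f_integral.
Qed.

Lemma integrable_sqr_Lfun2 d (T : measurableType d) (R : realType)
    (mu : {measure set T -> \bar R}) (f : T -> R) :
  measurable_fun [set: T] f -> (\int[mu]_x (f x ^+ 2)%:E < +oo)%E ->
  f \in Lfun mu 2%:E.
Proof.
move=> mf foo; rewrite inE; apply/andP; split; rewrite inE//=.
rewrite /finite_norm unlock /Lnorm poweR_lty//.
under eq_integral do rewrite /= powR_mulrn// -normrX ger0_norm ?sqr_ge0//.
by [].
Qed.

Lemma cvg_quadraticM_expRN (R : realType) :
  (x ^+ 2 / 2 + x + 1) * expR (- x) @[x --> +oo] --> (0 : R).
Proof.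
(* For [x > 1], both [x] and [x ^+ 2] are at most [x ^+ 3], so [x] times the quadratic is at most
   [5/2 * x ^+ 3]. The bound [1 + x ^+ 3 / 6 <= expR x] then gives the constant [15 = 6 * 5/2]. *)
apply: (@squeeze_cvgr _ _ _ _ (cst 0) (fun x => 15 / x)).
- near=> x.
  have x1 : 1 < x by near: x; exact: nbhs_pinfty_gt.
  have x0 : 0 < x by rewrite (lt_trans _ x1).
  apply/andP; split.
    by rewrite /= mulr_ge0 ?expR_ge0// !addr_ge0 ?divr_ge0 ?sqr_ge0// ltW.
  rewrite expRN ler_pdivrMr ?expR_gt0// [leRHS]mulrAC ler_pdivlMr//.
  have := expR_ge1Dxn 2 (ltW x0).
  rewrite (_ : 3`!%:R = 6 :> R)//.
  have : 0 <= (x - 1) * x ^+ 2 by rewrite mulr_ge0 ?sqr_ge0// subr_ge0 ltW.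
  have : 0 <= (x - 1) * x by rewrite mulr_ge0 ?subr_ge0 ?ltW.
  rewrite !exprS expr0.
  nra.
- exact: cvg_cst.
- rewrite -[X in _ --> X](mulr0 15); apply: cvgMl_tmp.
  apply/gtr0_cvgV0; last exact: cvg_id.
  by near=> x; near: x; exact: nbhs_pinfty_gt.
Unshelve. all: end_near. Qed.

(** * The Laplace density and its second moment *)

Section laplace_pdf.
Context {R : realType} (b : R).
Hypothesis b_gt0 : 0 < b.
Notation mu := (@lebesgue_measure R).

Lemma laplace_pdf_ge0 x : 0 <= laplace_pdf b x.
Proof. by rewrite mulr_ge0 ?expR_ge0// invr_ge0 mulr_ge0// ltW. Qed.

Lemma laplace_pdfN x : laplace_pdf b (- x) = laplace_pdf b x.
Proof. by rewrite /laplace_pdf normrN. Qed.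

Lemma continuous_laplace_pdf : continuous (laplace_pdf b).
Proof.
rewrite -[laplace_pdf b]/(fun z => (2 * b)^-1 * expR (- `|z| / b)) => x.
apply: (@continuousM _ R^o (fun=> (2 * b)^-1) (fun z => expR (- `|z| / b))).
  exact: cst_continuous.
apply: continuous_comp; last exact: continuous_expR.
apply: continuousM; last exact: cst_continuous.
by apply: (@continuousN _ R^o); exact: norm_continuous.
Qed.

Lemma measurable_laplace_pdf : measurable_fun [set: R] (laplace_pdf b).
Proof. by apply: continuous_measurable_fun; exact: continuous_laplace_pdf. Qed.

(* Antiderivative of [x ^+ 2 * laplace_pdf b x] on the nonnegative reals. *)
Let F x := - ((x ^+ 2 / 2 + b * x + b ^+ 2) * expR (- x / b)).

Let is_deriveF (x : R) :
  is_derive x 1 F (x ^+ 2 * ((2 * b)^-1 * expR (- x / b))).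
Proof.
rewrite /F; apply: is_derive_eq.
rewrite !scaler0 !add0r !addr0 /GRing.scale /=.
by field; rewrite gt_eqF.
Qed.

Let cvgF : F x @[x --> +oo] --> 0.
Proof.
have -> : F = (fun x => - b ^+ 2 * x) \o
    (fun y => (y ^+ 2 / 2 + y + 1) * expR (- y)) \o (fun x => x / b).
  apply/funext => x; rewrite /F /= [- x / b]mulNr.
  by field; rewrite gt_eqF.
rewrite -(mulr0 (- b ^+ 2)); apply: cvgMl_tmp.
apply: cvg_comp (@cvg_quadraticM_expRN R).
by apply: gt0_cvgMly; rewrite ?invr_gt0.
Qed.

Let continuous_sqrM_pdf : continuous (fun x : R => x ^+ 2 * laplace_pdf b x).
Proof.
move=> x; apply: (@continuousM _ R^o (fun x => x ^+ 2) (laplace_pdf b));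
  last exact: continuous_laplace_pdf.
exact: exprn_continuous.
Qed.

(** The integrand is even, so it suffices to double the integral over the half-line, along which the
    antiderivative [F] goes from [- b ^+ 2] at 0 to 0 at infinity. *)
Lemma laplace_pdf_second_moment :
  (\int[mu]_x (x ^+ 2 * laplace_pdf b x)%:E = (2 * b ^+ 2)%:E)%E.
Proof.
rewrite ge0_symfun_integralT//; last 2 first.
- by move=> x; rewrite mulr_ge0 ?sqr_ge0 ?laplace_pdf_ge0.
- by move=> x /=; rewrite sqrrN laplace_pdfN.
rewrite -set_itvcy (@ge0_continuous_FTC2y _ _ F 0 0)//.
- rewrite -EFinB -EFinM /F; congr EFin.
  by rewrite oppr0 mul0r expR0; field.
- by move=> x _; rewrite mulr_ge0 ?sqr_ge0 ?laplace_pdf_ge0.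
- exact: continuous_subspaceT.
- by apply/cvg_at_right_filter/differentiable_continuous/derivable1_diffP.
- move=> x; rewrite in_itv/= andbT => x0.
  have [_ DF] := is_deriveF x.
  by rewrite derive1E DF /laplace_pdf ger0_norm// ltW.
Qed.

End laplace_pdf.

(** * Mean and variance of a Laplace variable *)

Section laplace_random_variable.
Context d {T : measurableType d} {R : realType} (P : probability T R)
  (X : {RV P >-> R}) (b : R).
Hypotheses (b_gt0 : 0 < b) (lapX : is_laplace P X b).

(* [R] and [measurableTypeR R], on which [lebesgue_measure] lives, carry the
   same measurable sets but different displays. *)
Let mX : measurable_fun [set: T] (X : T -> measurableTypeR R).
Proof. exact: (measurable_funP X). Qed.
Let X' : {RV P >-> measurableTypeR R} :=
  HB.pack (X : T -> measurableTypeR R) (isMeasurableFun.Build _ _ _ _ _ mX).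

Lemma laplace_integral_sqr : (\int[P]_w (X w ^+ 2)%:E = (2 * b ^+ 2)%:E)%E.
Proof.
have msqr : measurable_fun [set: measurableTypeR R]
    (fun x : measurableTypeR R => ((x : R) ^+ 2)%:E).
  by apply/measurable_EFinP; exact: measurable_funX.
have sqr_ge0 (x : measurableTypeR R) : (0 <= ((x : R) ^+ 2)%:E)%E.
  by rewrite lee_fin sqr_ge0.
rewrite -laplace_pdf_second_moment//.
rewrite -[LHS](ge0_integral_distribution X' msqr sqr_ge0).
rewrite (@ge0_integral_density _ _ _ (distribution P X') (@lebesgue_measure R)
  (fun z => (laplace_pdf b z)%:E))//.
- by apply/measurable_EFinP; exact: measurable_laplace_pdf.
- by move=> x; rewrite lee_fin laplace_pdf_ge0.
Qed.

Lemma laplace_Lfun2 : (X : T -> R) \in Lfun P 2%:E.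
Proof.
by apply: integrable_sqr_Lfun2 => //; rewrite laplace_integral_sqr ltry.
Qed.

Lemma laplace_Lfun1 : (X : T -> R) \in Lfun P 1.
Proof. by apply: Lfun_subset12 laplace_Lfun2; rewrite fin_num_measure. Qed.

(** The density is even and Lebesgue measure is invariant under negation, so the change of variables
    [z] to [- z] preserves the law. *)
Lemma laplace_distributionN A : measurable A ->
  distribution P (- X : {RV P >-> R})%R A = distribution P X A.
Proof.
move=> mA.
have mN : measurable_fun [set: measurableTypeR R]
    (-%R : _ -> measurableTypeR R).
  exact: oppr_measurable.
have mNA : measurable ((-%R : R -> R) @^-1` A).
  by rewrite -[X in measurable X]setTI; exact: mN.
transitivity (distribution P X (-%R @^-1` A)) => //.
rewrite !lapX//.
transitivity (\int[pushforward (@lebesgue_measure R)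
    (-%R : _ -> measurableTypeR R)]_(x in A) (laplace_pdf b x)%:E)%E.
  rewrite ge0_integral_pushforward//.
  - by apply: eq_integral => x _ /=; rewrite laplace_pdfN.
  - by apply/measurable_funTS/measurable_EFinP; exact: measurable_laplace_pdf.
  - by move=> x _; rewrite lee_fin laplace_pdf_ge0.
by apply: eq_measure_integral => B mB _; exact: lebesgue_measureN.
Qed.

Lemma laplace_expectation : ('E_P[X] = 0)%E.
Proof.
have iX := (Lfun1_integrable P X).1 laplace_Lfun1.
(* The expectation depends only on the law, which [X] and [- X] share. *)
have EN : ('E_P[X] = - 'E_P[X])%E.
  rewrite -mulN1e -[(-1)%E]/((-1)%:E) -expectationZl ?laplace_Lfun1//.
  rewrite (_ : -1 \o* (X : T -> R) = (- X : {RV P >-> R})%R); last first.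
    by apply/funext => w /=; rewrite mulrN1.
  rewrite !unlock -[LHS](@integral_distribution _ _ _ _ _ _ X EFin)//.
  rewrite -[RHS](@integral_distribution _ _ _ _ _ _ 
    (- X : {RV P >-> R})%R EFin)//.
    by apply: eq_measure_integral => A mA _; exact/esym/laplace_distributionN.
  by rewrite (_ : _ \o _ = fun w => - (EFin \o X) w)%E//; exact: integrableN.
(* As the mean is finite, the identity can be read in [R], where it forces 0. *)
move: EN; rewrite -(fineK (expectation_fin_num laplace_Lfun1)) -EFinN.
by move=> [?]; congr EFin; lra.
Qed.

Lemma laplace_variance : ('V_P[X] = (2 * b ^+ 2)%:E)%E.
Proof.
rewrite varianceE ?laplace_Lfun2// laplace_expectation expe2 mule0 sube0.
by rewrite unlock laplace_integral_sqr.
Qed.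

End laplace_random_variable.

(** * Independence, covariance, and moments of linear combinations *)

Section independence.
Context d {T : measurableType d} {R : realType} (P : probability T R).

Lemma mutually_independent_pair (I : finType) (Z : I -> {RV P >-> R}) i j
    (A B : set R) : mutually_independent P Z -> i != j ->
  measurable A -> measurable B ->
  P (Z i @^-1` A `&` Z j @^-1` B) = (P (Z i @^-1` A) * P (Z j @^-1` B))%E.
Proof.
move=> indZ ij mA mB.
(* Mutual independence is used on the index set of [i] and [j] alone, so assigning [B] to every
   index other than [i] is harmless. *)
have mAB k : measurable (if k == i then A else B) by case: ifP.
have jU : j \in [set i; j]%SET :\ i by rewrite !inE eq_sym ij eqxx orbT.
have iU : i \in [set i; j]%SET by rewrite !inE eqxx.
have := indZ [set i; j]%SET _ mAB.
by rewrite !big_setU1/= ?inE// !big_set1 eqxx eq_sym (negbTE ij).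
Qed.

(** The joint law is the product of the two laws, because they agree on rectangles; Fubini then
    separates the factors. Square integrability of [X] and [Y] makes the product integrable. *)
Lemma expectationM (X Y : {RV P >-> R}) :
  (X : T -> R) \in Lfun P 2%:E -> (Y : T -> R) \in Lfun P 2%:E ->
  (forall A B : set R, measurable A -> measurable B ->
    P (X @^-1` A `&` Y @^-1` B) = (P (X @^-1` A) * P (Y @^-1` B))%E) ->
  ('E_P[(X : T -> R) * (Y : T -> R)] = 'E_P[X] * 'E_P[Y])%E.
Proof.
move=> X2 Y2 indXY.
have X1 : (X : T -> R) \in Lfun P 1.
  by apply: Lfun_subset12 X2; rewrite fin_num_measure.
have Y1 : (Y : T -> R) \in Lfun P 1.
  by apply: Lfun_subset12 Y2; rewrite fin_num_measure.
have iX := (Lfun1_integrable _ _).1 X1.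
have iY := (Lfun1_integrable _ _).1 Y1.
have iXY := (Lfun1_integrable _ _).1 (Lfun2_mul_Lfun1 X2 Y2).
have mXY : measurable_fun [set: T] (fun w => (X w, Y w)).
  exact: measurable_fun_pair.
pose XY : {RV P >-> (R * R)%type} := HB.pack (fun w => (X w, Y w))
  (isMeasurableFun.Build _ _ _ _ _ mXY).
have lawXY A : measurable A ->
    (distribution P X \x distribution P Y)%E A = distribution P XY A.
  by apply: product_measure_unique => B C mB mC; rewrite -indXY.
pose f (z : R * R) := (z.1 * z.2)%:E.
have mf : measurable_fun [set: R * R] f.
  by apply/measurable_EFinP; exact: measurable_funM.
have ifXY : (distribution P XY).-integrable setT f.
  exact: integrable_pushforward.
(* Fubini needs integrability against the product measure; it is carried over from the joint law,
   the two measures being equal. *)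
have ifp : (distribution P X \x distribution P Y)%E.-integrable setT f.
  apply/integrableP; split=> //.
  have /integrableP[_] := ifXY.
  rewrite (eq_measure_integral (distribution P X \x distribution P Y)%E)//.
  by move=> A mA _; exact/esym/lawXY.
transitivity (\int[P]_w f (XY w))%E; first by rewrite unlock.
rewrite -[LHS](@integral_distribution _ _ _ _ _ _ XY f)//.
transitivity (\int[(distribution P X \x distribution P Y)%E]_z f z)%E.
  by apply: eq_measure_integral => A mA _; exact/esym/lawXY.
rewrite -integral12_prod_meas1//.
transitivity (\int[distribution P X]_x (x%:E * 'E_P[Y]))%E.
  apply: eq_integral => x _; rewrite /fubini_F /f /=.
  under eq_integral do rewrite EFinM.
  rewrite integralZl//; last exact: integrable_pushforward.
  by rewrite unlock -[in RHS](@integral_distribution _ _ _ _ _ _ Y EFin).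
rewrite -(fineK (expectation_fin_num Y1)) integralZr//; last first.
  exact: integrable_pushforward.
by rewrite (@integral_distribution _ _ _ _ _ _ X EFin)// -expectation_def.
Qed.

Lemma covariance_independent (X Y : {RV P >-> R}) :
  (X : T -> R) \in Lfun P 2%:E -> (Y : T -> R) \in Lfun P 2%:E ->
  (forall A B : set R, measurable A -> measurable B ->
    P (X @^-1` A `&` Y @^-1` B) = (P (X @^-1` A) * P (Y @^-1` B))%E) ->
  covariance P X Y = 0%E.
Proof.
move=> X2 Y2 indXY.
have X1 := Lfun_subset12 (fin_num_measure P _ measurableT) X2.
have Y1 := Lfun_subset12 (fin_num_measure P _ measurableT) Y2.
rewrite covarianceE ?Lfun2_mul_Lfun1// expectationM// subee//.
by rewrite fin_numM// expectation_fin_num.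
Qed.

Lemma expectation_lin_comb (I : finType) (a : I -> R) (Z : I -> T -> R) :
  (forall i, Z i \in Lfun P 1) ->
  ('E_P[(\sum_i (a i \o* Z i))%R] = \sum_i (a i)%:E * 'E_P[Z i])%E.
Proof.
move=> Z1.
have aZ1 i : (a i \o* Z i : T -> R) \in Lfun P 1 by exact: Lfun_scale.
suff E s : ('E_P[(\sum_(i <- s) (a i \o* Z i))%R] =
    \sum_(i <- s) (a i)%:E * 'E_P[Z i])%E.
  exact: E.
elim: s => [|i s IH]; first by rewrite !big_nil (expectation_cst _ 0).
by rewrite !big_cons expectationD ?rpred_sum// IH expectationZl.
Qed.

Lemma variance_sum (I : finType) (Z : I -> T -> R) :
  (forall i, Z i \in Lfun P 2%:E) ->
  (forall i j, i != j -> covariance P (Z i) (Z j) = 0%E) ->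
  ('V_P[(\sum_i Z i)%R] = \sum_i 'V_P[Z i])%E.
Proof.
move=> Z2 cov0; have sum2 (s : seq I) : (\sum_(i <- s) Z i)%R \in Lfun P 2%:E.
  by rewrite rpred_sum ?lee1n//.
(* This kills the cross term when [Z i] is added to a partial sum. *)
have covs i s : i \notin s -> covariance P (Z i) (\sum_(j <- s) Z j)%R = 0%E.
  elim: s => [|j s IH]; first by rewrite big_nil (covariance_cst_r _ _ 0).
  rewrite inE negb_or => /andP[ij si].
  by rewrite big_cons covarianceDr// cov0// IH// adde0.
(* The induction runs over duplicate-free lists: a repeated index would contribute a covariance of
   [Z i] with itself. *)
suff: forall s, uniq s ->
    ('V_P[(\sum_(i <- s) Z i)%R] = \sum_(i <- s) 'V_P[Z i])%E.
  by apply; exact: index_enum_uniq.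
elim=> [|i s IH]; first by rewrite !big_nil (variance_cst _ 0).
move=> /andP[si us].
by rewrite !big_cons varianceD// IH// covs// mule0 adde0.
Qed.

Lemma variance_lin_comb (I : finType) (a : I -> R) (Z : I -> T -> R) :
  (forall i, Z i \in Lfun P 2%:E) ->
  (forall i j, i != j -> covariance P (Z i) (Z j) = 0%E) ->
  ('V_P[(\sum_i (a i \o* Z i))%R] = \sum_i (a i ^+ 2)%:E * 'V_P[Z i])%E.
Proof.
move=> Z2 cov0.
have Z1 i := Lfun_subset12 (fin_num_measure P _ measurableT) (Z2 i).
have aZ2 i : (a i \o* Z i : T -> R) \in Lfun P 2%:E.
  by apply: Lfun_scale; rewrite ?ler1n.
rewrite variance_sum// => [|i j ij].
  by apply: eq_bigr => i _; rewrite varianceZ.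
rewrite covarianceZl ?(Lfun2_mul_Lfun1 (Z2 i) (aZ2 j)) ?Lfun_scale//.
by rewrite covarianceZr ?Lfun2_mul_Lfun1// cov0// !mule0.
Qed.

End independence.

(** * Bias and variance of the combined estimator *)

Theorem mainTheorem9 (R : realType) (eps : R) (n : nat) (x y : 'I_n -> R)
  (d : measure_display) (T : measurableType d) (P : probability T R)
  (Z11 Z12 Z13 Z21 Z22 Z23 : {RV P >-> R}) :
  0 < eps ->
  (forall i, 0 <= x i <= 1) -> (forall i, 0 <= y i <= 1) ->
  let eps1 := eps / 2 in
  let eps2 := eps / 2 in
  mutually_independent P
    (fun k : 'I_6 => nth Z11 [:: Z11; Z12; Z13; Z21; Z22; Z23] k) ->
  is_laplace P Z11 eps1^-1 -> is_laplace P Z12 eps1^-1 ->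
  is_laplace P Z13 eps1^-1 ->
  is_laplace P Z21 eps2^-1 -> is_laplace P Z22 eps2^-1 ->
  is_laplace P Z23 eps2^-1 ->
  let S_x2 := \sum_i x i ^+ 2 in
  let S_xmx2 := \sum_i (x i - x i ^+ 2) in
  let S_1mx := \sum_i (1 - x i) in
  let S_xy := \sum_i x i * y i in
  let S_1mxy := \sum_i (1 - x i) * y i in
  let S_1my := \sum_i (1 - y i) in
  let tS_x2 := fun w => S_x2 + Z11 w in
  let tS_xmx2 := fun w => S_xmx2 + Z12 w in
  let tS_1mx := fun w => S_1mx + Z13 w in
  let tS_xy := fun w => S_xy + Z21 w in
  let tS_1mxy := fun w => S_1mxy + Z22 w in
  let tS_1my := fun w => S_1my + Z23 w in
  let tn_x := fun w => tS_x2 w + tS_xmx2 w + tS_1mx w in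
  let hS_xy := fun w : T =>
    5 / 6 * tS_xy w + 1 / 6 * (tn_x w - (tS_1mxy w + tS_1my w)) in
  ('E_P[hS_xy] = S_xy%:E /\ 'V_P[hS_xy] = (20 / (3 * eps ^+ 2))%:E)%E.
Proof.
move=> eps_gt0 _ _ eps1 eps2 indZ l11 l12 l13 l21 l22 l23 S_x2 S_xmx2 S_1mx S_xy
  S_1mxy S_1my tS_x2 tS_xmx2 tS_1mx tS_xy tS_1mxy tS_1my tn_x hS_xy.
pose Z (k : 'I_6) := nth Z11 [:: Z11; Z12; Z13; Z21; Z22; Z23] k.
pose a (k : 'I_6) : R :=
  nth 0 [:: 1 / 6; 1 / 6; 1 / 6; 5 / 6; - 1 / 6; - 1 / 6] k.
have b_gt0 : 0 < (eps / 2)^-1 by rewrite invr_gt0 divr_gt0.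
(* One case per index; beyond the sixth the ordinal bound is absurd, so the default of [nth] never
   arises. *)
have lapZ k : is_laplace P (Z k) (eps / 2)^-1.
  by case: k => -[|[|[|[|[|[|]]]]]].
have Z2 k : (Z k : T -> R) \in Lfun P 2%:E by exact: laplace_Lfun2 (lapZ k).
have Z1 k : (Z k : T -> R) \in Lfun P 1 by exact: laplace_Lfun1 (lapZ k).
have covZ i j : i != j -> covariance P (Z i) (Z j) = 0%E.
  move=> ij; apply: covariance_independent => // A B mA mB.
  exact: mutually_independent_pair indZ ij mA mB.
have hSE : hS_xy = cst S_xy \+ (\sum_k (a k \o* (Z k : T -> R))).
  (* The noiseless second estimate is exact term by term: the [x] statistics add up to 1, and
     [1 - ((1 - x) * y + (1 - y)) = x * y]. The weights [5 / 6] and [1 / 6] add up to 1, so the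
     signal is [S_xy]. *)
  have S_eq : S_x2 + S_xmx2 + S_1mx - (S_1mxy + S_1my) = S_xy.
    by rewrite -!big_split -sumrB; apply: eq_bigr => i _ /=; ring.
  apply/funext => w; rewrite /= fct_sumE !big_ord_recl big_ord0 /a /Z.
  rewrite /hS_xy /tn_x /tS_x2 /tS_xmx2 /tS_1mx /tS_xy /tS_1mxy /tS_1my -S_eq.
  by rewrite /=; field.
rewrite {}hSE; split.
- rewrite expectationD ?Lfun_cst//; last first.
    by rewrite rpred_sum// => k _; exact: Lfun_scale.
  rewrite expectation_cst expectation_lin_comb// big1 ?adde0// => k _.
  by rewrite (laplace_expectation b_gt0 (lapZ k)) mule0.
- rewrite varianceD_cst_l; last first.
    rewrite rpred_sum ?lee1n// => *; rewrite Lfun_scale ?ler1n//.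
  rewrite variance_lin_comb//.
  under eq_bigr do rewrite (laplace_variance b_gt0 (lapZ _)) -EFinM.
  rewrite sumEFin; congr EFin; rewrite !big_ord_recl big_ord0 /a /=.
  field; exact: lt0r_neq0.
Qed.
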